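(* Let $s\ge1$ be an integer and $n=2^s$. Let $G_n$ be the unitary group of the Clifford algebra $Cl(\mathbb R^s)$, let $(e_I)_I$ be the standard basis of $Cl(\mathbb R^s)$, indexed by the $n$ subsets $I\subset\{1,\dots,s\}$, and identify the algebra of endomorphisms of (the complexification of) $Cl(\mathbb R^s)$ with $M_n(\mathbb C)$. For $y\in G_n$ let $P_y\in M_n(\mathbb C)$ be the orthogonal projection onto the line $\mathbb C y$. Then there is a $\mathbb C^*$-algebra representation $$\pi_n:A_{aut}(X_n)\to C(G_n,M_n(\mathbb C))$$ mapping the universal $n\times n$ magic biunitary matrix $u$, with rows and columns indexed by the subsets $I,J\subset\{1,\dots,s\}$, to the $n\times n$ matrix $v$ of functions of $x\in G_n$ given by $$v(x)=\left(P_{e_Ixe_J}\right)_{I,J},$$ that is, $\pi_n(u_{IJ})(x)=P_{e_Ixe_J}$.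
   Context: **Magic biunitaries and $A_{aut}(X_n)$.** Let $A$ be a unital $\mathbb C^*$-algebra. A projection is $p\in A$ with $p^2=p^*=p$. A partition of unity is a finite family of mutually orthogonal projections ($pq=0$) summing to $1$. A matrix $v\in M_n(A)$ is magic biunitary if each of its rows and each of its columns is a partition of unity of $A$. $A_{aut}(X_n)$, with $X_n=\{1,\dots,n\}$, is the universal unital $\mathbb C^*$-algebra generated by $n^2$ elements $u_{ij}$ subject to the relations making $u=(u_{ij})$ a magic biunitary matrix. This $u$ is the universal $n\times n$ magic biunitary matrix. A representation is a unital $*$-homomorphism into a unital $\mathbb C^*$-algebra. **Clifford algebra.** $Cl(\mathbb R^s)$ is the finite dimensional algebra generated by $e_1,\dots,e_s$ with relations $e_i^2=-1$ and $e_ie_j=-e_je_i$ for $i\ne j$. It has basis $e_I=e_{i_1}\cdots e_{i_k}$, for $I=(i_1,\dots,i_k)$ with $1\le i_1<\dots<i_k\le s$ (and $e_\emptyset=1$), hence dimension $n=2^s$. It is a real algebra with involution the antiautomorphism $x\mapsto x^*$ determined by $e_i^*=-e_i$. Its unitary group is the compact group $G_n=\{x\in Cl(\mathbb R^s): xx^*=x^*x=1\}$ (for $s=2$ one has $Cl(\mathbb R^2)=$ quaternions and $G_4=SU(2)$). Orthogonality is with respect to the Hermitian inner product on the complexification $Cl(\mathbb R^s)\otimes\mathbb C\simeq\mathbb C^n$ for which the $e_I$ form an orthonormal basis. Here $C(G_n,M_n(\mathbb C))$ is the algebra of continuous functions $G_n\to M_n(\mathbb C)$. *)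

(* Defs.v *)
From HB Require Import structures.
From mathcomp Require Import all_boot all_order all_algebra ring.
From mathcomp Require Import all_classical all_reals all_analysis.
From mathcomp Require Import complex.
Set Implicit Arguments.
Unset Strict Implicit.
Unset Printing Implicit Defensive.
Import Order.TTheory GRing.Theory Num.Theory.
Import numFieldNormedType.Exports.
Local Open Scope ring_scope.
Local Open Scope complex_scope.

HB.instance Definition _ (R : realType) := NormedModule.copy R[i] R[i]^o.

Notation cmod := ComplexField.Normc.normc.

(* Unital C*-algebras over R[i]. The norm is a field of its own, with values in
   R, because the MathComp hierarchy has no structure joining noncommutative
   rings with normed modules; completeness is then stated for sequences.
   [algType] imposes 1 != 0. *)
HB.mixin Record isCStarAlgebra (R : realType) (A : Type) & GRing.Algebra R[i] A := {
  star : A -> A;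
  starD : {morph star : x y / x + y};
  starZ : forall (a : R[i]) (x : A), star (a *: x) = a^* *: star x;
  starM : forall x y : A, star (x * y) = star y * star x;
  starK : involutive star;
  cnorm : A -> R;
  cnormD : forall x y : A, cnorm (x + y) <= cnorm x + cnorm y;
  cnormZ : forall (a : R[i]) (x : A), cnorm (a *: x) = cmod a * cnorm x;
  cnorm_eq0 : forall x : A, cnorm x = 0 -> x = 0;
  cnormM : forall x y : A, cnorm (x * y) <= cnorm x * cnorm y;
  cnorm_star : forall x : A, cnorm (star x * x) = cnorm x ^+ 2;
  cnorm_complete : forall a : nat -> A,
    (forall e : R, 0 < e -> exists N : nat, forall m n : nat,
       (N <= m)%N -> (N <= n)%N -> cnorm (a m - a n) <= e) ->
    exists l : A, forall e : R, 0 < e -> exists N : nat, forall n : nat,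
       (N <= n)%N -> cnorm (a n - l) <= e
}.

#[short(type="cstarAlgType")]
HB.structure Definition CStarAlgebra (R : realType) :=
  {A of GRing.Algebra R[i] A & isCStarAlgebra R A}.

Section MagicBiunitary.
Variables (R : realType) (A : cstarAlgType R).

Definition is_projection (p : A) : Prop := p * p = p /\ star p = p.

Definition partition_of_unity (I : finType) (p : I -> A) : Prop :=
  [/\ forall i, is_projection (p i),
      forall i j, i != j -> p i * p j = 0
    & \sum_i p i = 1].

Definition magic_biunitary (n : nat) (v : 'M[A]_n) : Prop :=
  (forall i, partition_of_unity (fun j => v i j)) /\
  (forall j, partition_of_unity (fun i => v i j)).
End MagicBiunitary.

Definition star_morphism (R : realType) (A B : cstarAlgType R) (f : A -> B) :=
  [/\ linear f, GRing.monoid_morphism f & {morph f : x / star x}].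

(* (A, u) is A_aut(X_n) with its universal magic biunitary matrix. Uniqueness of
   f expresses that A is generated by the entries of u. Being defined by its
   universal property, (A, u) is determined up to a unique isomorphism. *)
Definition is_Aaut (R : realType) (n : nat) (A : cstarAlgType R) (u : 'M[A]_n) :=
  magic_biunitary u /\
  forall (B : cstarAlgType R) (v : 'M[B]_n), magic_biunitary v ->
    exists! f : A -> B, star_morphism f /\ map_mx f u = v.

Lemma card_subsets s : #|{set 'I_s}| = (2 ^ s)%N.
Proof. by rewrite -cardsT -powersetT card_powerset cardsT card_ord. Qed.

(* The identification of the subsets of {1, ..., s} with the indices 0 <= k < 2 ^ s
   used for coordinates and for matrices. *)
Definition set_idx s (I : {set 'I_s}) : 'I_(2 ^ s) :=
  cast_ord (card_subsets s) (enum_rank I).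

Definition idx_set s (k : 'I_(2 ^ s)) : {set 'I_s} :=
  enum_val (cast_ord (esym (card_subsets s)) k).

Lemma set_idxK s : cancel (@set_idx s) (@idx_set s).
Proof. by move=> I; rewrite /idx_set /set_idx cast_ordK enum_rankK. Qed.

Lemma idx_setK s : cancel (@idx_set s) (@set_idx s).
Proof. by move=> k; rewrite /idx_set /set_idx enum_valK cast_ordKV. Qed.

(* The Clifford algebra, as the space of coordinates in the basis (e_I). *)
Definition Cl (R : realType) (s : nat) : Type := 'rV[R]_(2 ^ s).
HB.instance Definition _ (R : realType) (s : nat) :=
  NormedModule.copy (Cl R s) 'rV[R]_(2 ^ s).

Section Clifford.
Variables (R : realType) (s : nat).
Implicit Types (I J K : {set 'I_s}) (x y z : Cl R s).

Definition cl_coord x I : R := (x : 'rV[R]_(2 ^ s)) 0 (set_idx I).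

Definition cl_basis I : Cl R s := delta_mx 0 (set_idx I).

Definition symdiff I J : {set 'I_s} := (I :\: J) :|: (J :\: I).

(* e_I e_J = cl_sign I J e_(I + J), where I + J is the symmetric difference:
   moving e_j to the left past e_i costs a sign for each i in I, j in J with
   j < i, and e_i ^ 2 = -1 accounts for the pairs with j = i. The defining
   relations are checked in [cl_gen_sq], [cl_gen_anticomm], [cl_basis_prod]. *)
Definition cl_sign I J : R :=
  \prod_(i in I) \prod_(j in J) (if (j <= i)%N then -1 else 1).

Definition cl_mul x y : Cl R s :=
  \sum_I \sum_J (cl_coord x I * cl_coord y J * cl_sign I J) *:
    cl_basis (symdiff I J).

(* Each e_I is unitary, so its adjoint is its inverse cl_sign I I e_I. That this
   is the antiautomorphism with e_i |-> - e_i is [cl_starM], [cl_star_gen]. *)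
Definition cl_star x : Cl R s :=
  \sum_I (cl_coord x I * cl_sign I I) *: cl_basis I.

Lemma cl_coordD x y I : cl_coord (x + y) I = cl_coord x I + cl_coord y I.
Proof. by rewrite /cl_coord mxE. Qed.
Lemma cl_coordZ a x I : cl_coord (a *: x) I = a * cl_coord x I.
Proof. by rewrite /cl_coord mxE. Qed.
Lemma cl_coord_basis I J : cl_coord (cl_basis I) J = (J == I)%:R.
Proof. by rewrite /cl_coord mxE eqxx /= (can_eq (@set_idxK s)). Qed.

Lemma cl_expand x : x = \sum_I cl_coord x I *: cl_basis I.
Proof.
rewrite [LHS]row_sum_delta (reindex (@set_idx s)) //=.
by exists (@idx_set s) => ? _; rewrite ?set_idxK ?idx_setK.
Qed.

Lemma cl_coord_inj x y : (forall I, cl_coord x I = cl_coord y I) -> x = y.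
Proof.
by move=> h; rewrite (cl_expand x) (cl_expand y); apply: eq_bigr => I _; rewrite h.
Qed.

Lemma symdiffE I J i : (i \in symdiff I J) = (i \in I) (+) (i \in J).
Proof. by rewrite !inE; case: (i \in I); case: (i \in J). Qed.
Lemma symdiffA : associative symdiff.
Proof. by move=> I J K; apply/setP => i; rewrite !symdiffE addbA. Qed.
Lemma symdiffC : commutative symdiff.
Proof. by move=> I J; apply/setP => i; rewrite !symdiffE addbC. Qed.
Lemma symdiffI I : symdiff I I = finset.set0.
Proof. by apply/setP => i; rewrite symdiffE addbb inE. Qed.
Lemma sym0diff : left_id finset.set0 symdiff.
Proof. by move=> I; apply/setP => i; rewrite symdiffE inE. Qed.
Lemma symdiff0 : right_id finset.set0 symdiff.
Proof. by move=> I; rewrite symdiffC sym0diff. Qed.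

Lemma prod_symdiff (g : 'I_s -> R) I J : (forall i, g i * g i = 1) ->
  \prod_(i in symdiff I J) g i = (\prod_(i in I) g i) * (\prod_(i in J) g i).
Proof.
move=> g1; rewrite [in RHS](big_mkcond (mem I)) [in RHS](big_mkcond (mem J)) /=.
rewrite -big_split /= big_mkcond /=; apply: eq_bigr => i _.
by rewrite symdiffE; case: (i \in I); case: (i \in J); rewrite /= ?g1 ?mulr1 ?mul1r.
Qed.

Lemma prod_sq1 (P : pred 'I_s) (g : 'I_s -> R) : (forall i, g i * g i = 1) ->
  (\prod_(i | P i) g i) * (\prod_(i | P i) g i) = 1.
Proof. by move=> g1; rewrite -big_split /= big1. Qed.

Lemma if_sq1 (b : bool) : (if b then -1 else 1) * (if b then -1 else 1) = 1 :> R.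
Proof. by case: b; rewrite ?mulrNN mulr1. Qed.

Lemma cl_sign_symdiffl I J K :
  cl_sign (symdiff I J) K = cl_sign I K * cl_sign J K.
Proof. by apply: prod_symdiff => i; apply: prod_sq1 => j; exact: if_sq1. Qed.

Lemma cl_sign_symdiffr I J K :
  cl_sign I (symdiff J K) = cl_sign I J * cl_sign I K.
Proof.
rewrite /cl_sign -big_split /=; apply: eq_bigr => i _.
by apply: prod_symdiff => j; exact: if_sq1.
Qed.

Lemma cl_sign0l I : cl_sign finset.set0 I = 1.
Proof. by rewrite /cl_sign big_set0. Qed.
Lemma cl_sign0r I : cl_sign I finset.set0 = 1.
Proof. by rewrite /cl_sign big1 // => i _; rewrite big_set0. Qed.
Lemma cl_sign_sq I J : cl_sign I J * cl_sign I J = 1.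
Proof. by apply: prod_sq1 => i; apply: prod_sq1 => j; exact: if_sq1. Qed.

Lemma cl_basisM I J :
  cl_mul (cl_basis I) (cl_basis J) = cl_sign I J *: cl_basis (symdiff I J).
Proof.
rewrite /cl_mul (bigD1 I) //= (bigD1 J) //= !cl_coord_basis !eqxx !mul1r.
rewrite big1 => [|K /negPf nK]; last first.
  by rewrite cl_coord_basis nK mulr0 mul0r scale0r.
rewrite addr0 big1 ?addr0 // => K /negPf nK; rewrite big1 // => L _.
by rewrite cl_coord_basis nK !mul0r scale0r.
Qed.

Lemma cl_mulDl : left_distributive cl_mul +%R.
Proof.
move=> x y z; rewrite /cl_mul -big_split /=; apply: eq_bigr => I _.
rewrite -big_split /=; apply: eq_bigr => J _.
by rewrite cl_coordD !mulrDl scalerDl.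
Qed.
Lemma cl_mulDr : right_distributive cl_mul +%R.
Proof.
move=> x y z; rewrite /cl_mul -big_split /=; apply: eq_bigr => I _.
rewrite -big_split /=; apply: eq_bigr => J _.
by rewrite cl_coordD !(mulrDl, mulrDr) scalerDl.
Qed.
Lemma cl_mulZl a x y : cl_mul (a *: x) y = a *: cl_mul x y.
Proof.
rewrite /cl_mul scaler_sumr; apply: eq_bigr => I _.
rewrite scaler_sumr; apply: eq_bigr => J _.
by rewrite cl_coordZ scalerA; congr (_ *: _); ring.
Qed.
Lemma cl_mulZr a x y : cl_mul x (a *: y) = a *: cl_mul x y.
Proof.
rewrite /cl_mul scaler_sumr; apply: eq_bigr => I _.
rewrite scaler_sumr; apply: eq_bigr => J _.
by rewrite cl_coordZ scalerA; congr (_ *: _); ring.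
Qed.
Lemma cl_mul0l x : cl_mul 0 x = 0.
Proof. by have := cl_mulZl 0 0 x; rewrite !scale0r. Qed.
Lemma cl_mul0r x : cl_mul x 0 = 0.
Proof. by have := cl_mulZr 0 x 0; rewrite !scale0r. Qed.
Lemma cl_suml (f : {set 'I_s} -> Cl R s) y :
  cl_mul (\sum_I f I) y = \sum_I cl_mul (f I) y.
Proof. by apply: (big_morph (cl_mul^~ y)) => [a b|]; rewrite ?cl_mulDl ?cl_mul0l. Qed.
Lemma cl_sumr (f : {set 'I_s} -> Cl R s) y :
  cl_mul y (\sum_I f I) = \sum_I cl_mul y (f I).
Proof. by apply: (big_morph (cl_mul y)) => [a b|]; rewrite ?cl_mulDr ?cl_mul0r. Qed.

Lemma cl_mulA : associative cl_mul.
Proof.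
pose term (w : Cl R s) I := cl_coord w I *: cl_basis I.
move=> x y z; rewrite {1 2}(cl_expand x) !(cl_suml (term x)).
rewrite (cl_suml (fun I => cl_mul (term x I) y)).
apply: eq_bigr => I _; rewrite {1 2}(cl_expand y) (cl_suml (term y)).
rewrite (cl_sumr (fun J => cl_mul (term y J) z)) (cl_sumr (term y)).
rewrite (cl_suml (fun J => cl_mul (term x I) (term y J))).
apply: eq_bigr => J _; rewrite {1 2}(cl_expand z) !(cl_sumr (term z)).
rewrite (cl_sumr (fun K => cl_mul (term y J) (term z K))).
apply: eq_bigr => K _; rewrite /term.
rewrite !(cl_mulZl, cl_mulZr) !cl_basisM !(cl_mulZl, cl_mulZr) !cl_basisM.
rewrite !scalerA symdiffA cl_sign_symdiffl cl_sign_symdiffr; congr (_ *: _).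
ring.
Qed.

Lemma cl_mul1l : left_id (cl_basis finset.set0) cl_mul.
Proof.
move=> x; rewrite (cl_expand x) cl_sumr; apply: eq_bigr => I _.
by rewrite cl_mulZr cl_basisM cl_sign0l scale1r sym0diff.
Qed.
Lemma cl_mul1r : right_id (cl_basis finset.set0) cl_mul.
Proof.
move=> x; rewrite (cl_expand x) cl_suml; apply: eq_bigr => I _.
by rewrite cl_mulZl cl_basisM cl_sign0r scale1r symdiff0.
Qed.
Lemma cl_1neq0 : cl_basis finset.set0 != 0.
Proof.
apply/eqP => /(congr1 (cl_coord^~ finset.set0)) /eqP.
by rewrite cl_coord_basis eqxx /cl_coord mxE oner_eq0.
Qed.
End Clifford.
HB.instance Definition _ (R : realType) (s : nat) :=
  GRing.Zmodule_isNzRing.Build (Cl R s) (@cl_mulA R s) (@cl_mul1l R s)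
    (@cl_mul1r R s) (@cl_mulDl R s) (@cl_mulDr R s) (@cl_1neq0 R s).

Lemma cl_scalerAl (R : realType) (s : nat) (a : R) (x y : Cl R s) :
  a *: (x * y) = (a *: x) * y.
Proof. exact/esym/cl_mulZl. Qed.
HB.instance Definition _ (R : realType) (s : nat) :=
  GRing.Lmodule_isLalgebra.Build R (Cl R s) (@cl_scalerAl R s).
Lemma cl_scalerAr (R : realType) (s : nat) (a : R) (x y : Cl R s) :
  a *: (x * y) = x * (a *: y).
Proof. exact/esym/cl_mulZr. Qed.
HB.instance Definition _ (R : realType) (s : nat) :=
  GRing.Lalgebra_isAlgebra.Build R (Cl R s) (@cl_scalerAr R s).

Section CliffordTheory.
Variables (R : realType) (s : nat).
Implicit Types (I J : {set 'I_s}) (i j : 'I_s) (x y : Cl R s).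

Definition cl_gen i : Cl R s := cl_basis R [set i]%SET.

Lemma cl_basis0 : cl_basis R finset.set0 = 1 :> Cl R s. Proof. by []. Qed.

Lemma cl_basis_mul I J :
  cl_basis R I * cl_basis R J = cl_sign R I J *: cl_basis R (symdiff I J).
Proof. exact: cl_basisM. Qed.

Lemma cl_sign1 i j :
  cl_sign R [set i]%SET [set j]%SET = if (j <= i)%N then -1 else 1.
Proof. by rewrite /cl_sign !big_set1. Qed.

Lemma cl_gen_sq i : cl_gen i * cl_gen i = -1.
Proof. by rewrite cl_basis_mul symdiffI cl_sign1 leqnn scaleN1r. Qed.

Lemma cl_gen_anticomm i j : i != j -> cl_gen i * cl_gen j = - (cl_gen j * cl_gen i).
Proof.
rewrite !cl_basis_mul !cl_sign1 symdiffC -val_eqE /= => /negPf ij.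
by case: ltngtP ij => // _ _; rewrite ?scaleN1r ?scale1r ?opprK.
Qed.

Lemma cl_basis_prod I : cl_basis R I = \prod_(i <- enum I) cl_gen i.
Proof.
have: sorted ltn (map val (enum I)).
  rewrite {1}/enum_mem -enumT /=.
  apply: (subseq_sorted ltn_trans) (iota_ltn_sorted 0 s).
  by rewrite -val_enum_ord; apply/map_subseq/filter_subseq.
have -> : cl_basis R I = cl_basis R [set i in enum I]%SET.
  by congr cl_basis; apply/setP => i; rewrite inE mem_enum.
elim: (enum I) => [_|i r IH /=]; first by rewrite big_nil -cl_basis0; congr cl_basis; apply/setP => i; rewrite !inE.
rewrite (path_sortedE ltn_trans) => /andP[/allP lti /IH ir].
rewrite big_cons -ir cl_basis_mul /cl_sign big_set1 big1 => [|j]; last first.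
  by rewrite inE => /(map_f val)/lti /= ij; rewrite leqNgt ij.
rewrite scale1r; congr cl_basis; apply/setP => j; rewrite symdiffE !inE.
have [->|//] := eqVneq j i.
by case: (boolP (i \in r)) => // /(map_f val)/lti; rewrite /= ltnn.
Qed.

Lemma cl_starD : {morph @cl_star R s : x y / x + y}.
Proof.
move=> x y; rewrite /cl_star -big_split /=; apply: eq_bigr => I _.
by rewrite cl_coordD mulrDl scalerDl.
Qed.

Lemma cl_starZ a x : cl_star (a *: x) = a *: cl_star x.
Proof.
rewrite /cl_star scaler_sumr; apply: eq_bigr => I _.
by rewrite cl_coordZ scalerA mulrA.
Qed.

Lemma cl_star_basis I : cl_star (cl_basis R I) = cl_sign R I I *: cl_basis R I.
Proof.
rewrite /cl_star (bigD1 I) //= cl_coord_basis eqxx mul1r big1 ?addr0 //.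
by move=> J /negPf nJ; rewrite cl_coord_basis nJ mul0r scale0r.
Qed.

Lemma cl_star_sum (f : {set 'I_s} -> Cl R s) :
  cl_star (\sum_I f I) = \sum_I cl_star (f I).
Proof.
apply: (big_morph (@cl_star R s)) => [a b|]; first exact: cl_starD.
by have := cl_starZ 0 0; rewrite !scale0r.
Qed.

Lemma cl_starM x y : cl_star (x * y) = cl_star y * cl_star x.
Proof.
rewrite (cl_expand x) (cl_expand y) mulr_suml !cl_star_sum mulr_sumr.
apply: eq_bigr => I _; rewrite mulr_sumr cl_star_sum mulr_suml.
apply: eq_bigr => J _.
rewrite -!scalerAl -!scalerAr !cl_starZ !cl_basis_mul !cl_starZ !cl_star_basis.
rewrite -!(scalerAl, scalerAr) !cl_basis_mul !scalerA [symdiff J I]symdiffC.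
rewrite !(cl_sign_symdiffl, cl_sign_symdiffr); congr (_ *: _).
have := cl_sign_sq R I J; set a := cl_sign R I J => a2.
transitivity ((a * a) * (cl_coord x I * cl_coord y J * cl_sign R I I *
  cl_sign R J J * cl_sign R J I)); first by ring.
by rewrite a2; ring.
Qed.

Lemma cl_star_gen i : cl_star (cl_gen i) = - cl_gen i.
Proof. by rewrite cl_star_basis cl_sign1 leqnn scaleN1r. Qed.

Lemma cl_starK : involutive (@cl_star R s).
Proof.
move=> x; rewrite [in RHS](cl_expand x) {2}/cl_star cl_star_sum.
apply: eq_bigr => I _.
by rewrite cl_starZ cl_star_basis scalerA -mulrA cl_sign_sq mulr1.
Qed.

Lemma cl_star1 : cl_star 1 = 1 :> Cl R s.
Proof. by rewrite -cl_basis0 cl_star_basis cl_sign0l scale1r. Qed.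
End CliffordTheory.
Section Hilbert.
Variables (R : realType).
Implicit Types (a b : R[i]).

Lemma cmodM a b : cmod (a * b) = cmod a * cmod b.
Proof. exact: ComplexField.Normc.normcM. Qed.
Lemma cmodD a b : cmod (a + b) <= cmod a + cmod b.
Proof. exact: (@le_normcD R). Qed.
Lemma cmod_ge0 a : 0 <= cmod a.
Proof. by case: a => x y; exact: sqrtr_ge0. Qed.
Lemma normE a : `|a| = (cmod a)%:C.
Proof. by []. Qed.
Lemma cmodJ a : cmod a^* = cmod a.
Proof. by case: a => x y /=; rewrite sqrrN. Qed.
Lemma cmodN a : cmod (- a) = cmod a.
Proof. exact: (@normcN R). Qed.
Lemma cmod0 : cmod (0 : R[i]) = 0.
Proof. exact: ComplexField.Normc.normc0. Qed.
Lemma cmod_eq0 a : cmod a = 0 -> a = 0.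
Proof. exact: ComplexField.Normc.eq0_normc. Qed.
Lemma cmod_sum (I : finType) (f : I -> R[i]) :
  cmod (\sum_i f i) <= \sum_i cmod (f i).
Proof.
elim/big_ind2 : _ => [|x1 x2 y1 y2 h1 h2|//]; first by rewrite cmod0.
by apply: le_trans (cmodD _ _) _; apply: lerD.
Qed.
Lemma cmod_real (x : R) : cmod x%:C = `|x|.
Proof. by rewrite /= expr0n /= addr0 sqrtr_sqr. Qed.
Lemma cmod_sqr a : (cmod a ^+ 2)%:C = a^* * a.
Proof. by rewrite rmorphXn /= -normE sqr_normc mulrC. Qed.
Lemma conjE a : Num.conj a = a^*. Proof. by []. Qed.

Lemma real_cauchy (n : nat) (p q : 'I_n -> R) :
  (\sum_i p i * q i) ^+ 2 <= (\sum_i p i ^+ 2) * (\sum_i q i ^+ 2).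
Proof.
have : 0 <= \sum_i \sum_j (p i * q j - p j * q i) ^+ 2.
  by apply: sumr_ge0 => i _; apply: sumr_ge0 => j _; exact: sqr_ge0.
have -> : \sum_i \sum_j (p i * q j - p j * q i) ^+ 2 =
    ((\sum_i p i ^+ 2) * (\sum_i q i ^+ 2) - (\sum_i p i * q i) ^+ 2) *+ 2.
  rewrite mulrnBl expr2 !big_distrlr /= mulr2n [in X in X + _ - _]exchange_big /=.
  rewrite -!sumrMnl -big_split -sumrB /=.
  apply: eq_bigr => i _; rewrite -sumrMnl -big_split -sumrB /=.
  by apply: eq_bigr => j _; ring.
by rewrite pmulrn_lge0 // subr_ge0.
Qed.

Section VNorm.
Variable n : nat.
Implicit Types (u v : 'cV[R[i]]_n) (A B : 'M[R[i]]_n).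

Definition l2norm v : R := Num.sqrt (\sum_i cmod (v i 0) ^+ 2).

Lemma l2norm_ge0 v : 0 <= l2norm v. Proof. exact: sqrtr_ge0. Qed.
Lemma sum_cmod_ge0 v : 0 <= \sum_i cmod (v i 0) ^+ 2.
Proof. by apply: sumr_ge0 => i _; exact: sqr_ge0. Qed.
Lemma sqr_l2norm v : l2norm v ^+ 2 = \sum_i cmod (v i 0) ^+ 2.
Proof. by rewrite sqr_sqrtr // sum_cmod_ge0. Qed.
Lemma l2norm_cauchy u v :
  \sum_i cmod (u i 0) * cmod (v i 0) <= l2norm u * l2norm v.
Proof.
rewrite -(@ler_pXn2r _ 2) // ?nnegrE; last 2 first.
- by apply: sumr_ge0 => i _; rewrite mulr_ge0 ?cmod_ge0.
- by rewrite mulr_ge0 ?l2norm_ge0.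
by rewrite exprMn !sqr_l2norm; exact: real_cauchy.
Qed.
Lemma l2normD u v : l2norm (u + v) <= l2norm u + l2norm v.
Proof.
rewrite -(@ler_pXn2r _ 2) // ?nnegrE ?addr_ge0 ?l2norm_ge0 //.
rewrite sqrrD !sqr_l2norm.
apply: (@le_trans _ _ (\sum_i (cmod (u i 0) + cmod (v i 0)) ^+ 2)).
  apply: ler_sum => i _; rewrite mxE ler_pXn2r ?nnegrE ?addr_ge0 ?cmod_ge0 //.
  exact: cmodD.
under eq_bigr do rewrite sqrrD.
rewrite big_split /= lerD2r big_split /= lerD2l sumrMnl.
by rewrite ler_wMn2r // l2norm_cauchy.
Qed.
Lemma l2normZ a v : l2norm (a *: v) = cmod a * l2norm v.
Proof.
apply/eqP; rewrite -(@eqrXn2 _ 2) // ?mulr_ge0 ?cmod_ge0 ?l2norm_ge0 //.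
rewrite exprMn !sqr_l2norm mulr_sumr; apply/eqP/eq_bigr => i _.
by rewrite mxE cmodM exprMn.
Qed.
Lemma l2norm_eq0 v : l2norm v = 0 -> v = 0.
Proof.
move=> v0; have := sqr_l2norm v; rewrite v0 expr0n /= => /esym/eqP.
rewrite psumr_eq0 => [/allP h|i _]; last exact: sqr_ge0.
apply/colP => i; rewrite mxE; apply: cmod_eq0; apply/eqP.
by have := h i (mem_index_enum i); rewrite sqrf_eq0.
Qed.
Lemma l2norm0 : l2norm 0 = 0.
Proof. by rewrite -(scale0r 0) l2normZ cmod0 mul0r. Qed.
Lemma l2norm_coord v i : cmod (v i 0) <= l2norm v.
Proof.
rewrite -(@ler_pXn2r _ 2) // ?nnegrE ?l2norm_ge0 ?cmod_ge0 // sqr_l2norm.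
by rewrite (bigD1 i) //= lerDl sumr_ge0 // => j _; exact: sqr_ge0.
Qed.
Lemma l2norm_le_sum v : l2norm v <= \sum_i cmod (v i 0).
Proof.
rewrite -(@ler_pXn2r _ 2) // ?nnegrE ?l2norm_ge0 ?sumr_ge0 // => [|i _]; last first.
  exact: cmod_ge0.
rewrite sqr_l2norm expr2 mulr_suml; apply: ler_sum => i _; rewrite expr2.
apply: ler_wpM2l; first exact: cmod_ge0.
by rewrite (bigD1 i) //= lerDl sumr_ge0 // => j _; exact: cmod_ge0.
Qed.
Lemma l2norm_delta i : l2norm (delta_mx i 0) = 1.
Proof.
rewrite /l2norm (bigD1 i) //= mxE !eqxx big1 /= => [|j /negPf ji].
  by rewrite !expr0n /= !expr1n !addr0 !sqrtr1 expr1n sqrtr1.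
by rewrite mxE ji /= expr0n /= addr0 sqrtr0 expr0n.
Qed.

Definition opnorm A : R :=
  sup [set l2norm (A *m v) | v in [set v : 'cV[R[i]]_n | l2norm v <= 1]]%classic.

Definition entry_sum A : R := \sum_i \sum_j cmod (A i j).
Lemma l2norm_mul_bound A v : l2norm (A *m v) <= entry_sum A * l2norm v.
Proof.
apply: le_trans (l2norm_le_sum _) _; rewrite /entry_sum mulr_suml.
apply: ler_sum => i _; rewrite mxE mulr_suml.
apply: le_trans (cmod_sum _) _; apply: ler_sum => j _.
by rewrite cmodM ler_wpM2l ?cmod_ge0 ?l2norm_coord.
Qed.
Lemma entry_sum_ge0 A : 0 <= entry_sum A.
Proof. by apply: sumr_ge0 => i _; apply: sumr_ge0 => j _; exact: cmod_ge0. Qed.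

Lemma opnorm_has_sup A :
  has_sup [set l2norm (A *m v) | v in [set v : 'cV[R[i]]_n | l2norm v <= 1]]%classic.
Proof.
split; first by exists (l2norm (A *m 0)), 0 => //=; rewrite l2norm0.
exists (entry_sum A) => _ [v /= v1 <-]; apply: le_trans (l2norm_mul_bound _ _) _.
by rewrite ler_piMr ?entry_sum_ge0.
Qed.
Lemma opnorm_ge0 A : 0 <= opnorm A.
Proof.
apply: le_trans (l2norm_ge0 (A *m 0)) _.
by apply: (ub_le_sup (opnorm_has_sup A).2); exists 0 => //=; rewrite l2norm0.
Qed.
Lemma opnormP A v : l2norm (A *m v) <= opnorm A * l2norm v.
Proof.
have [v0|v0] := eqVneq (l2norm v) 0.
  by rewrite v0 mulr0 (l2norm_eq0 v0) mulmx0 l2norm0.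
have vp : 0 < l2norm v by rewrite lt_def v0 l2norm_ge0.
rewrite -ler_pdivrMr //.
have cv : cmod ((l2norm v)^-1%:C) = (l2norm v)^-1.
  by rewrite cmod_real ger0_norm // invr_ge0 l2norm_ge0.
apply: (ub_le_sup (opnorm_has_sup A).2); exists ((l2norm v)^-1%:C *: v) => /=.
  by rewrite l2normZ cv mulVf.
by rewrite -scalemxAr l2normZ cv mulrC.
Qed.
Lemma opnorm_le A c : 0 <= c -> (forall v, l2norm (A *m v) <= c * l2norm v) ->
  opnorm A <= c.
Proof.
move=> c0 h; apply: ge_sup (opnorm_has_sup A).1 _ => _ [v /= v1 <-].
by apply: le_trans (h v) _; rewrite ler_piMr.
Qed.
Lemma opnormD A B : opnorm (A + B) <= opnorm A + opnorm B.
Proof.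
apply: opnorm_le => [|v]; first by rewrite addr_ge0 ?opnorm_ge0.
by rewrite mulmxDl mulrDl; apply: le_trans (l2normD _ _) _; rewrite lerD ?opnormP.
Qed.
Lemma opnormM A B : opnorm (A *m B) <= opnorm A * opnorm B.
Proof.
apply: opnorm_le => [|v]; first by rewrite mulr_ge0 ?opnorm_ge0.
rewrite -mulmxA -mulrA; apply: le_trans (opnormP _ _) _.
by rewrite ler_wpM2l ?opnorm_ge0 ?opnormP.
Qed.
Lemma opnormZ_le a A : opnorm (a *: A) <= cmod a * opnorm A.
Proof.
apply: opnorm_le => [|v]; first by rewrite mulr_ge0 ?opnorm_ge0 ?cmod_ge0.
by rewrite -scalemxAl l2normZ -mulrA ler_wpM2l ?cmod_ge0 ?opnormP.
Qed.
Lemma opnorm_entry A i j : cmod (A i j) <= opnorm A.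
Proof.
have := opnormP A (delta_mx j 0); rewrite l2norm_delta mulr1.
apply: le_trans; rewrite -colE; apply: le_trans (l2norm_coord _ i).
by rewrite mxE.
Qed.
Lemma opnorm_le_entry_sum A : opnorm A <= entry_sum A.
Proof. by apply: opnorm_le (entry_sum_ge0 A) _ => v; exact: l2norm_mul_bound. Qed.

Definition adjmx A : 'M[R[i]]_n := map_mx Num.conj A^T.

Lemma adjmxK A : adjmx (adjmx A) = A.
Proof. by apply/matrixP => i j; rewrite !mxE conjCK. Qed.

Lemma opnorm_sqr_le A : opnorm A ^+ 2 <= opnorm (adjmx A *m A).
Proof.
set c := opnorm (adjmx A *m A).
have c0 : 0 <= c by exact: opnorm_ge0.
suff : opnorm A <= Num.sqrt c.
  move=> h; rewrite -(sqr_sqrtr c0).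
  by apply: lerXn2r => //; rewrite nnegrE ?opnorm_ge0 ?sqrtr_ge0.
apply: opnorm_le => [|v]; first exact: sqrtr_ge0.
rewrite -(@ler_pXn2r _ 2) ?nnegrE ?mulr_ge0 ?l2norm_ge0 ?sqrtr_ge0 //.
rewrite exprMn (sqr_sqrtr c0); set w := adjmx A *m A *m v.
apply: (@le_trans _ _ (\sum_i cmod (v i 0) * cmod (w i 0))); last first.
  apply: le_trans (l2norm_cauchy _ _) _.
  rewrite expr2 mulrCA; apply: ler_wpM2l; first exact: l2norm_ge0.
  exact: opnormP.
have -> : l2norm (A *m v) ^+ 2 = cmod (\sum_i (v i 0)^* * w i 0).
  rewrite -[LHS]ger0_norm ?sqr_ge0 // -cmod_real; congr cmod.
  rewrite sqr_l2norm rmorph_sum /=.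
  under eq_bigr do rewrite cmod_sqr.
  have -> : w = adjmx A *m (A *m v) by rewrite mulmxA.
  under [RHS]eq_bigr do rewrite [(adjmx A *m _) _ _]mxE mulr_sumr.
  rewrite exchange_big /=; apply: eq_bigr => k _.
  rewrite {1}[(A *m v) k 0]mxE rmorph_sum mulr_suml; apply: eq_bigr => i _.
  by rewrite !mxE conjE rmorphM mulrA (mulrC (A k i)^*).
apply: le_trans (cmod_sum _) _; apply: ler_sum => i _.
by rewrite cmodM cmodJ.
Qed.

Lemma opnorm_adj_le A : opnorm A <= opnorm (adjmx A).
Proof.
have [A0|A0] := eqVneq (opnorm A) 0; first by rewrite A0 opnorm_ge0.
have Ap : 0 < opnorm A by rewrite lt_def A0 opnorm_ge0.
rewrite -(ler_pM2r Ap) -expr2; apply: le_trans (opnorm_sqr_le A) _.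
exact: opnormM.
Qed.
Lemma opnorm_adj A : opnorm (adjmx A) = opnorm A.
Proof.
apply/eqP; rewrite eq_le opnorm_adj_le andbT.
by have := opnorm_adj_le (adjmx A); rewrite adjmxK.
Qed.
End VNorm.
End Hilbert.
Definition cl_unitary (R : realType) (s : nat) : set (Cl R s) :=
  [set x | x * cl_star x = 1 /\ cl_star x * x = 1]%classic.
Arguments cl_unitary : clear implicits.

(* [set_type] carries the topology induced by that of Cl R s. *)
Definition Gn (R : realType) (s : nat) : Type := set_type (cl_unitary R s).
HB.instance Definition _ (R : realType) (s : nat) :=
  Topological.copy (Gn R s) (set_type (cl_unitary R s)).

Definition CGn (R : realType) (s : nat) : Type :=
  continuousType (Gn R s) 'M[R[i]]_(2 ^ s).
HB.instance Definition _ (R : realType) (s : nat) :=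
  Choice.copy (CGn R s) (continuousType (Gn R s) 'M[R[i]]_(2 ^ s)).

Section Continuity.
Variable R : realType.

Lemma cvgCP (T : Type) (F : set_system T) {FF : Filter F} (f : T -> R[i]) (l : R[i]) :
  (f @ F --> l)%classic <->
  forall e : R, 0 < e -> \forall y \near F, cmod (l - f y) < e.
Proof.
split=> [/cvgrPdist_lt h e e0 | h].
  have := h e%:C; rewrite ltcR => /(_ e0); apply: filterS => y.
  by rewrite normE ltcR.
apply/cvgrPdist_lt => -[e e'] /[dup]; rewrite {1}ltcE /= => /andP[/eqP -> e0] _.
by have := h e e0; apply: filterS => y; rewrite normE ltcR.
Qed.

Lemma continuous_mxP (X : topologicalType) (n : nat) (f : X -> 'M[R[i]]_n) :
  continuous f <-> forall i j, continuous (fun x => f x i j).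
Proof.
split=> [cf i j x | h x A [P hP sPA]].
  apply: (@continuous_comp _ _ _ f (fun M : 'M[R[i]]_n => M i j)); first exact: cf.
  exact: coord_continuous.
suff : \forall y \near x, forall i j, P i j (f y i j).
  by apply: filterS => y hy; apply: sPA.
by apply: filter_forall => i; apply: filter_forall => j; apply: (h i j x); exact: hP.
Qed.

Lemma cmod_sub_le (a b : R[i]) : `|cmod a - cmod b| <= cmod (a - b).
Proof.
rewrite ler_norml; apply/andP; split.
  rewrite lerNl opprB lerBlDr -(cmodN (a - b)) opprB.
  by apply: le_trans (cmodD _ _); rewrite subrK.
by rewrite lerBlDr; apply: le_trans (cmodD _ _); rewrite subrK.
Qed.

Lemma continuous_cmod (X : topologicalType) (f : X -> R[i]) :
  continuous f -> continuous (fun x => cmod (f x) : R).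
Proof.
move=> cf x; apply/cvgrPdist_lt => e e0.
have /cvgCP/(_ e e0) := cf x; apply: filterS => y.
by apply: le_lt_trans; exact: cmod_sub_le.
Qed.

Lemma continuous_conjc (X : topologicalType) (f : X -> R[i]) :
  continuous f -> continuous (fun x => Num.conj (f x)).
Proof.
move=> cf x; apply/cvgCP => e e0.
have /cvgCP/(_ e e0) := cf x; apply: filterS => y.
by move=> h; rewrite -rmorphB; apply: le_lt_trans h; rewrite -(cmodJ (f x - f y)).
Qed.

Lemma continuous_fsum (K : numFieldType) (V : normedModType K) (X : topologicalType)
    (I : finType) (f : I -> X -> V) :
  (forall i, continuous (f i)) -> continuous (fun x => \sum_i f i x).
Proof.
move=> h x; elim: (index_enum I) => [|i r IH].
  rewrite (_ : (fun _ => _) = cst 0); first exact: cvg_cst.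
  by apply/funext => y; rewrite big_nil.
rewrite (_ : (fun _ => _) = fun y => f i y + \sum_(j <- r) f j y).
  by apply: cvgD IH; exact: h.
by apply/funext => y; rewrite big_cons.
Qed.

Section Mx.
Variables (X : topologicalType) (n : nat).
Implicit Types f g : X -> 'M[R[i]]_n.

Lemma continuous_addmx f g :
  continuous f -> continuous g -> continuous (fun x => f x + g x).
Proof. by move=> cf cg x; apply: cvgD; [exact: cf | exact: cg]. Qed.
Lemma continuous_oppmx f : continuous f -> continuous (fun x => - f x).
Proof. by move=> cf x; apply: cvgN; exact: cf. Qed.
Lemma continuous_scalemx (a : R[i]) f : continuous f -> continuous (fun x => a *: f x).
Proof. by move=> cf x; apply: cvgZr; exact: cf. Qed.
Lemma continuous_mulmx f g :
  continuous f -> continuous g -> continuous (fun x => f x *m g x).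
Proof.
move=> /continuous_mxP cf /continuous_mxP cg; apply/continuous_mxP => i j.
rewrite (_ : (fun _ => _) = fun x => \sum_k f x i k * g x k j); last first.
  by apply/funext => x; rewrite mxE.
by apply: continuous_fsum => k x; apply: cvgM; [exact: cf | exact: cg].
Qed.
Lemma continuous_adjmx f : continuous f -> continuous (fun x => adjmx (f x)).
Proof.
move=> /continuous_mxP cf; apply/continuous_mxP => i j.
rewrite (_ : (fun _ => _) = fun x => Num.conj (f x j i)); last first.
  by apply/funext => x; rewrite !mxE.
by apply: continuous_conjc; exact: cf.
Qed.
Lemma continuous_cstmx (A : 'M[R[i]]_n) : continuous (fun _ : X => A).
Proof. by move=> x; exact: cvg_cst. Qed.
End Mx.
End Continuity.

Section Algebra.
Variables (R : realType) (s : nat).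
Local Notation G := (Gn R s).
Local Notation M := 'M[R[i]]_(2 ^ s).
Local Notation CG := (CGn R s).
Implicit Types (f g h : CG) (x : G).

Definition cg_mk (f : G -> M) (cf : continuous f) : CG :=
  [the continuousType G M of mkcts cf].

Lemma cgP f g : (forall x, f x = g x) -> f = g.
Proof. by move=> fg; apply/continuousEP. Qed.

Lemma cg_cts f : continuous (f : G -> M). Proof. exact: cts_fun. Qed.

Definition cg_add f g : CG := cg_mk (continuous_addmx (@cg_cts f) (@cg_cts g)).
Definition cg_opp f : CG := cg_mk (continuous_oppmx (@cg_cts f)).
Definition cg_zero : CG := cg_mk (@continuous_cstmx R G _ 0).
Definition cg_mul f g : CG := cg_mk (continuous_mulmx (@cg_cts f) (@cg_cts g)).
Definition cg_one : CG := cg_mk (@continuous_cstmx R G _ 1%:M).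
Definition cg_scale (a : R[i]) f : CG := cg_mk (@continuous_scalemx R G _ a _ (@cg_cts f)).
Definition cg_star f : CG := cg_mk (continuous_adjmx (@cg_cts f)).

Fact cg_addA : associative cg_add.
Proof. by move=> f g h; apply: cgP => x; exact: addrA. Qed.
Fact cg_addC : commutative cg_add.
Proof. by move=> f g; apply: cgP => x; exact: addrC. Qed.
Fact cg_add0 : left_id cg_zero cg_add.
Proof. by move=> f; apply: cgP => x; exact: add0r. Qed.
Fact cg_addN : left_inverse cg_zero cg_opp cg_add.
Proof. by move=> f; apply: cgP => x; exact: addNr. Qed.
HB.instance Definition _ :=
  GRing.isZmodule.Build CG cg_addA cg_addC cg_add0 cg_addN.

Fact cg_mulA : associative cg_mul.
Proof. by move=> f g h; apply: cgP => x; exact: mulmxA. Qed.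
Fact cg_mul1l : left_id cg_one cg_mul.
Proof. by move=> f; apply: cgP => x; exact: mul1mx. Qed.
Fact cg_mul1r : right_id cg_one cg_mul.
Proof. by move=> f; apply: cgP => x; exact: mulmx1. Qed.
Fact cg_mulDl : left_distributive cg_mul +%R.
Proof. by move=> f g h; apply: cgP => x; exact: mulmxDl. Qed.
Fact cg_mulDr : right_distributive cg_mul +%R.
Proof. by move=> f g h; apply: cgP => x; exact: mulmxDr. Qed.

Lemma cl_unitary1 : (1 : Cl R s) \in cl_unitary R s.
Proof. by rewrite inE /cl_unitary /= cl_star1 mulr1. Qed.
Definition Gn1 : G := SigSub cl_unitary1.

Fact cg_1neq0 : cg_one != 0.
Proof.
apply/eqP => /(congr1 (fun f : CG => f Gn1 : M)) /matrixP.
have p : (0 < 2 ^ s)%N by rewrite expn_gt0.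
move/(_ (Ordinal p) (Ordinal p)) => /eqP.
by rewrite !mxE eqxx oner_eq0.
Qed.
HB.instance Definition _ := GRing.Zmodule_isNzRing.Build CG
  cg_mulA cg_mul1l cg_mul1r cg_mulDl cg_mulDr cg_1neq0.

Fact cg_scaleA a b f : cg_scale a (cg_scale b f) = cg_scale (a * b) f.
Proof. by apply: cgP => x; exact: scalerA. Qed.
Fact cg_scale1 : left_id 1 cg_scale.
Proof. by move=> f; apply: cgP => x; exact: scale1r. Qed.
Fact cg_scaleDr : right_distributive cg_scale +%R.
Proof. by move=> a f g; apply: cgP => x; exact: scalerDr. Qed.
Fact cg_scaleDl f : {morph cg_scale^~ f : a b / a + b}.
Proof. by move=> a b; apply: cgP => x; exact: scalerDl. Qed.
HB.instance Definition _ := GRing.Zmodule_isLmodule.Build R[i] CG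
  cg_scaleA cg_scale1 cg_scaleDr cg_scaleDl.
Fact cg_scaleAl (a : R[i]) f g : a *: (f * g) = (a *: f) * g.
Proof. by apply: cgP => x; exact: scalemxAl. Qed.
HB.instance Definition _ := GRing.Lmodule_isLalgebra.Build R[i] CG cg_scaleAl.
Fact cg_scaleAr (a : R[i]) f g : a *: (f * g) = f * (a *: g).
Proof. by apply: cgP => x; exact: scalemxAr. Qed.
HB.instance Definition _ := GRing.Lalgebra_isAlgebra.Build R[i] CG cg_scaleAr.

Lemma cgD f g x : (f + g) x = f x + g x. Proof. by []. Qed.
Lemma cgN f x : (- f) x = - f x. Proof. by []. Qed.
Lemma cgM f g x : (f * g) x = f x *m g x. Proof. by []. Qed.
Lemma cg1 x : (1 : CG) x = 1%:M. Proof. by []. Qed.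
Lemma cg0 x : (0 : CG) x = 0. Proof. by []. Qed.
Lemma cgZ a f x : (a *: f) x = a *: f x. Proof. by []. Qed.
Lemma cg_starE f x : cg_star f x = adjmx (f x). Proof. by []. Qed.
End Algebra.

Lemma continuous_mulr (K : numFieldType) (X : topologicalType) (f g : X -> K) :
  continuous f -> continuous g -> continuous (fun x => f x * g x).
Proof. by move=> cf cg x; apply: cvgM; [exact: cf | exact: cg]. Qed.

Section Compactness.
Variables (R : realType) (s : nat).

Lemma continuous_cl_coord (I : {set 'I_s}) :
  continuous (fun x : Cl R s => cl_coord x I : R).
Proof. exact: (@coord_continuous R 1 (2 ^ s) 0 (set_idx I)). Qed.

Lemma cl_star_coord (x : Cl R s) I :
  cl_coord (cl_star x) I = cl_coord x I * cl_sign R I I.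
Proof.
rewrite /cl_star /cl_coord summxE (bigD1 I) //= !mxE !eqxx mulr1 big1 ?addr0 //.
move=> J /negPf nJ.
by rewrite !mxE (can_eq (@set_idxK s)) (eq_sym I) nJ mulr0.
Qed.

Lemma cl_mul_coord (x y : Cl R s) K :
  cl_coord (x * y) K = \sum_I \sum_J
    cl_coord x I * cl_coord y J * cl_sign R I J * (K == symdiff I J)%:R.
Proof.
rewrite /cl_coord summxE; apply: eq_bigr => I _; rewrite summxE.
by apply: eq_bigr => J _; rewrite !mxE /= (can_eq (@set_idxK s)).
Qed.

Lemma continuous_cl_coordM (f g : Cl R s -> Cl R s) K :
  (forall I, continuous (fun x => cl_coord (f x) I : R)) ->
  (forall I, continuous (fun x => cl_coord (g x) I : R)) ->
  continuous (fun x => cl_coord (f x * g x) K : R).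
Proof.
move=> cf cg; rewrite (_ : (fun _ => _) = fun x => \sum_I \sum_J
    cl_coord (f x) I * cl_coord (g x) J * cl_sign R I J * (K == symdiff I J)%:R);
  last by apply/funext => x; exact: cl_mul_coord.
apply: (@continuous_fsum R R) => I; apply: (@continuous_fsum R R) => J.
apply: (@continuous_mulr R); last exact: cst_continuous.
apply: (@continuous_mulr R); last exact: cst_continuous.
by apply: (@continuous_mulr R); [exact: cf | exact: cg].
Qed.

Lemma continuous_cl_star_coord I :
  continuous (fun x : Cl R s => cl_coord (cl_star x) I : R).
Proof.
rewrite (_ : (fun _ => _) = fun x : Cl R s => cl_coord x I * cl_sign R I I); last first.
  by apply/funext => x; exact: cl_star_coord.
by apply: (@continuous_mulr R); [exact: continuous_cl_coord | exact: cst_continuous].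
Qed.

Lemma cl_mul_star_coord0 (x : Cl R s) :
  cl_coord (x * cl_star x) finset.set0 = \sum_I cl_coord x I ^+ 2.
Proof.
rewrite cl_mul_coord; apply: eq_bigr => I _.
rewrite (bigD1 I) //= symdiffI eqxx mulr1 cl_star_coord.
rewrite big1 => [|J JI]; last first.
  case: eqP => [E|]; last by rewrite mulr0.
  case/eqP: JI; have : symdiff I (symdiff I J) = I by rewrite -E symdiff0.
  by rewrite symdiffA symdiffI sym0diff.
by rewrite addr0 -!mulrA cl_sign_sq mulr1.
Qed.

Lemma cl_unitary_bounded : bounded_set (cl_unitary R s : set 'rV[R]_(2 ^ s)).
Proof.
exists 1; split => // c c1 x [xx _] /=.
rewrite [leLHS]mx_normrE; apply/bigmax_leP; split; first exact: le_trans (ltW c1).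
move=> [a k] _ /=; apply: le_trans (ltW c1).
rewrite (ord1 a) -[k]idx_setK.
have := cl_mul_star_coord0 x; rewrite xx -cl_basis0 cl_coord_basis eqxx mulr1n => E.
rewrite -(@ler_pXn2r _ 2) ?nnegrE // expr1n -normrX ger0_norm ?sqr_ge0 // E.
by rewrite (bigD1 (idx_set k)) //= lerDl sumr_ge0 // => J _; exact: sqr_ge0.
Qed.

Lemma cl_unitary_closed : closed (cl_unitary R s : set 'rV[R]_(2 ^ s)).
Proof.
have cl1 (f : Cl R s -> Cl R s) : (forall I, continuous (fun x => cl_coord (f x) I : R)) ->
    closed ([set x | f x = 1]%classic : set 'rV[R]_(2 ^ s)).
  move=> cf; rewrite (_ : [set x | _]%classic = (\bigcap_(I in setT)
      ((fun x : Cl R s => cl_coord (f x) I : R) @^-1` [set r | r = cl_coord 1 I]))%classic).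
    apply: closed_bigI => I _; apply: preimage_closed => [y _|]; first exact: cf.
    exact: closed_eq.
  apply/seteqP; split => x /=; first by move=> fx I _ /=; rewrite fx.
  by move=> h; apply: cl_coord_inj => I; exact: h.
rewrite (_ : cl_unitary R s = ([set x | x * cl_star x = 1] `&`
  [set x | cl_star x * x = 1])%classic) //.
apply: closedI; apply: cl1 => I; apply: continuous_cl_coordM => J;
  by [exact: continuous_cl_coord | exact: continuous_cl_star_coord].
Qed.

Lemma cl_unitary_compact : compact (cl_unitary R s : set 'rV[R]_(2 ^ s)).
Proof. exact: bounded_closed_compact cl_unitary_bounded cl_unitary_closed. Qed.

Local Open Scope classical_set_scope.
Lemma Gn_compact : compact [set: Gn R s]%classic.
Proof.
move=> F FF _; pose U := cl_unitary R s.
have FU : (set_val @ F : set_system (Cl R s)) U.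
  by rewrite /fmap /=; apply: filterS filterT => x _; exact: (set_mem (valP x)).
have [p [Up clp]] := cl_unitary_compact (fmap_proper_filter _ FF) FU.
exists (SigSub (mem_set Up)); split=> // A B FA [W Q]; move: Q => [Q Wp WB]; case: Q => V oV VO.
have nA : (set_val @ F : set_system (Cl R s)) (set_val @` A).
  by rewrite /fmap /=; apply: filterS FA => x Ax; exists x.
have nV : nbhs (p : Cl R s) V.
  by apply: open_nbhs_nbhs; split=> //; move: Wp; rewrite -VO.
have [q] := clp _ _ nA nV.
move=> [X Vx]; case: X Vx => x Ax <- Vx.
by exists x; split=> //; apply: WB; rewrite -VO.
Qed.
End Compactness.

Lemma continuousCP (R : realType) (X : topologicalType) (f : X -> R[i]) :
  continuous f <->
  forall x (e : R), 0 < e -> \forall y \near x, cmod (f x - f y) < e.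
Proof.
split=> [cf x e e0 | h x]; first by have /cvgCP := cf x; exact.
by apply/cvgCP => e e0; exact: h.
Qed.

Section SequenceLimits.
Variable R : realType.

Lemma real_seq_limit (u : nat -> R) :
  (forall e, 0 < e -> exists N : nat, forall m n : nat,
     (N <= m)%N -> (N <= n)%N -> `|u m - u n| <= e) ->
  exists l, forall (e : R) (N : nat), 
    (forall m n : nat, (N <= m)%N -> (N <= n)%N -> `|u m - u n| <= e) ->
    forall n, (N <= n)%N -> `|u n - l| <= e.
Proof.
move=> cu; have /cvg_ex[l ul] : cvg (u @ \oo)%classic.
  apply: R_complete; apply/cauchyP => e e0.
  have [N hN] := cu _ (divr_gt0 e0 (ltr0n _ 2)).
  exists (u N); exists N => // n /= Nn.
  rewrite /ball /= (le_lt_trans (hN _ _ (leqnn N) Nn)) //.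
  by rewrite ltr_pdivrMr // ltr_pMr // ltr1n.
exists l => e N h n Nn; apply/ler_addgt0Pr => d d0.
move/cvgrPdist_lt/(_ d d0) : ul => [M _ hM].
have := hM (maxn N M) (leq_maxr _ _); have := h n (maxn N M) Nn (leq_maxl _ _).
set w := u (maxn N M) => h1 /ltW h2.
rewrite -(subrK w (u n)) -addrA; apply: le_trans (ler_normD _ _) _.
by rewrite lerD // distrC.
Qed.

Lemma cmod_le (a : R[i]) : cmod a <= `|complex.Re a| + `|complex.Im a|.
Proof.
case: a => x y /=; rewrite -(@ler_pXn2r _ 2) ?nnegrE ?sqrtr_ge0 ?addr_ge0 //.
rewrite sqr_sqrtr ?addr_ge0 ?sqr_ge0 // sqrrD -!normrX.
rewrite !(ger0_norm (sqr_ge0 _)) lerD2r lerDl mulrn_wge0 // mulr_ge0 //.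
Qed.
Lemma Re_le_cmod (a : R[i]) : `|complex.Re a| <= cmod a.
Proof.
case: a => x y /=; rewrite -(@ler_pXn2r _ 2) ?nnegrE ?sqrtr_ge0 //.
by rewrite sqr_sqrtr ?addr_ge0 ?sqr_ge0 // -normrX ger0_norm ?sqr_ge0 // lerDl sqr_ge0.
Qed.
Lemma Im_le_cmod (a : R[i]) : `|complex.Im a| <= cmod a.
Proof.
case: a => x y /=; rewrite -(@ler_pXn2r _ 2) ?nnegrE ?sqrtr_ge0 //.
by rewrite sqr_sqrtr ?addr_ge0 ?sqr_ge0 // -normrX ger0_norm ?sqr_ge0 // lerDr sqr_ge0.
Qed.

Lemma complex_seq_limit (u : nat -> R[i]) :
  (forall e, 0 < e -> exists N : nat, forall m n : nat,
     (N <= m)%N -> (N <= n)%N -> cmod (u m - u n) <= e) ->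
  exists l, forall (e : R) (N : nat),
    (forall m n : nat, (N <= m)%N -> (N <= n)%N -> cmod (u m - u n) <= e) ->
    forall n, (N <= n)%N -> cmod (u n - l) <= e + e.
Proof.
move=> cu.
have reB (a b : R[i]) : complex.Re a - complex.Re b = complex.Re (a - b).
  by case: a => ? ?; case: b.
have imB (a b : R[i]) : complex.Im a - complex.Im b = complex.Im (a - b).
  by case: a => ? ?; case: b.
have [|x hx] := @real_seq_limit (fun n => complex.Re (u n)).
  move=> e /cu[N hN]; exists N => m n Nm Nn; rewrite reB.
  by apply: le_trans (Re_le_cmod _) _; exact: hN.
have [|y hy] := @real_seq_limit (fun n => complex.Im (u n)).
  move=> e /cu[N hN]; exists N => m n Nm Nn; rewrite imB.
  by apply: le_trans (Im_le_cmod _) _; exact: hN.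
exists (x +i* y) => e N h n Nn; apply: le_trans (cmod_le _) _.
rewrite -reB -imB /=; apply: lerD.
  apply: hx Nn => m k Nm Nk; rewrite reB.
  by apply: le_trans (Re_le_cmod _) _; exact: h.
apply: hy Nn => m k Nm Nk; rewrite imB.
by apply: le_trans (Im_le_cmod _) _; exact: h.
Qed.
End SequenceLimits.

Section Norm.
Variables (R : realType) (s : nat).
Local Notation G := (Gn R s).
Local Notation M := 'M[R[i]]_(2 ^ s).
Local Notation CG := (CGn R s).
Implicit Types (f g h : CG) (x : G).

(* The C*-norm of C(G_n, M_n(C)): the supremum over G_n of the operator norm. *)
Definition cg_norm f : R := sup [set opnorm (f x : M) | x in [set: G]]%classic.

Lemma continuous_entry_sum f : continuous (fun x => entry_sum (f x : M) : R).
Proof.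
have /continuous_mxP cf := @cg_cts _ _ f.
apply: (@continuous_fsum R R) => i; apply: (@continuous_fsum R R) => j.
exact: continuous_cmod.
Qed.

Lemma cg_norm_has_sup f : has_sup [set opnorm (f x : M) | x in [set: G]]%classic.
Proof.
split; first by exists (opnorm (f (Gn1 R s) : M)), (Gn1 R s).
have : compact ((fun x => entry_sum (f x : M) : R) @` [set: G])%classic.
  apply: continuous_compact; last exact: Gn_compact.
  by apply: continuous_subspaceT; exact: continuous_entry_sum.
move/compact_bounded => [c [_ hc]]; exists (c + 1) => _ [x _ <-].
apply: le_trans (opnorm_le_entry_sum _) _; apply: le_trans (ler_norm _) _.
by apply: (hc (c + 1)); [rewrite ltrDl | exists x].
Qed.

Lemma cg_norm_ge f x : opnorm (f x : M) <= cg_norm f.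
Proof. by apply: (ub_le_sup (cg_norm_has_sup f).2); exists x. Qed.
Lemma cg_norm_le f (c : R) : (forall x, opnorm (f x : M) <= c) -> cg_norm f <= c.
Proof. by move=> h; apply: ge_sup (cg_norm_has_sup f).1 _ => _ [x _ <-]. Qed.
Lemma cg_norm_ge0 f : 0 <= cg_norm f.
Proof. exact: le_trans (opnorm_ge0 _) (cg_norm_ge f (Gn1 R s)). Qed.

Fact cg_normD f g : cg_norm (f + g) <= cg_norm f + cg_norm g.
Proof.
apply: cg_norm_le => x; apply: le_trans (opnormD _ _) _.
by rewrite lerD ?cg_norm_ge.
Qed.
Fact cg_normM f g : cg_norm (f * g) <= cg_norm f * cg_norm g.
Proof.
apply: cg_norm_le => x; apply: le_trans (opnormM _ _) _.
by rewrite ler_pM ?cg_norm_ge ?opnorm_ge0.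
Qed.
Lemma cg_normZ_le a f : cg_norm (a *: f) <= cmod a * cg_norm f.
Proof.
apply: cg_norm_le => x; apply: le_trans (opnormZ_le _ _) _.
by rewrite ler_wpM2l ?cg_norm_ge ?cmod_ge0.
Qed.
Fact cg_normZ (a : R[i]) f : cg_norm (a *: f) = cmod a * cg_norm f.
Proof.
apply/eqP; rewrite eq_le cg_normZ_le /=.
have [->|a0] := eqVneq a 0; first by rewrite cmod0 mul0r cg_norm_ge0.
have ap : 0 < cmod a.
  by rewrite lt_def cmod_ge0 andbT; apply: contra_neq a0 => /cmod_eq0.
rewrite mulrC -ler_pdivlMr // mulrC -(ComplexField.Normc.normcV a).
by rewrite -{1}[f]scale1r -(mulVf a0) -scalerA cg_normZ_le.
Qed.
Fact cg_norm_eq0 f : cg_norm f = 0 -> f = 0.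
Proof.
move=> f0; apply: cgP => x; apply/matrixP => i j; rewrite cg0 [RHS]mxE.
apply: cmod_eq0; apply/eqP; rewrite eq_le cmod_ge0 andbT -f0.
exact: le_trans (opnorm_entry _ _ _) (cg_norm_ge _ _).
Qed.

Fact cg_starD : {morph @cg_star R s : f g / f + g}.
Proof. by move=> f g; apply: cgP => x; apply/matrixP => i j; rewrite !mxE rmorphD. Qed.
Fact cg_starZ (a : R[i]) f : cg_star (a *: f) = a^* *: cg_star f.
Proof. by apply: cgP => x; apply/matrixP => i j; rewrite !mxE rmorphM. Qed.
Fact cg_starM f g : cg_star (f * g) = cg_star g * cg_star f.
Proof.
apply: cgP => x; apply/matrixP => i j; rewrite !mxE rmorph_sum.
by apply: eq_bigr => k _; rewrite !mxE rmorphM mulrC.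
Qed.
Fact cg_starK : involutive (@cg_star R s).
Proof. by move=> f; apply: cgP => x; exact: adjmxK. Qed.
Lemma cg_norm_adj f : cg_norm (cg_star f) <= cg_norm f.
Proof. by apply: cg_norm_le => x; rewrite cg_starE opnorm_adj cg_norm_ge. Qed.
Fact cg_norm_star f : cg_norm (cg_star f * f) = cg_norm f ^+ 2.
Proof.
apply/eqP; rewrite eq_le; apply/andP; split.
  apply: le_trans (cg_normM _ _) _.
  by rewrite expr2 ler_wpM2r ?cg_norm_ge0 ?cg_norm_adj.
rewrite -(sqr_sqrtr (cg_norm_ge0 (cg_star f * f))).
apply: lerXn2r; rewrite ?nnegrE ?cg_norm_ge0 ?sqrtr_ge0 //.
apply: cg_norm_le => x; rewrite -(ger0_norm (opnorm_ge0 _)) -sqrtr_sqr ler_sqrt.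
  by apply: le_trans (opnorm_sqr_le _) _; exact: (cg_norm_ge (cg_star f * f)).
exact: cg_norm_ge0.
Qed.

Fact cg_norm_complete (a : nat -> CG) :
  (forall e : R, 0 < e -> exists N : nat, forall m n : nat,
     (N <= m)%N -> (N <= n)%N -> cg_norm (a m - a n) <= e) ->
  exists l : CG, forall e : R, 0 < e -> exists N : nat, forall n : nat,
     (N <= n)%N -> cg_norm (a n - l) <= e.
Proof.
move=> ca; have entry x i j m n :
    cmod ((a m x : M) i j - (a n x : M) i j) <= cg_norm (a m - a n).
  have := opnorm_entry ((a m - a n) x : M) i j; rewrite cgD cgN !mxE => h.
  exact: le_trans h (cg_norm_ge (a m - a n) x).
have lim x i j : exists l, forall (e : R) (N : nat),
    (forall m n : nat, (N <= m)%N -> (N <= n)%N ->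
       cmod ((a m x : M) i j - (a n x : M) i j) <= e) ->
    forall n, (N <= n)%N -> cmod ((a n x : M) i j - l) <= e + e.
  apply: complex_seq_limit => e /ca[N hN]; exists N => m n Nm Nn.
  by apply: le_trans (entry _ _ _ _ _) _; exact: hN.
pose L x : M := \matrix_(i, j) projT1 (cid (lim x i j)).
have LP e : 0 < e -> exists N : nat, forall n, (N <= n)%N -> forall x i j,
    cmod ((a n x : M) i j - L x i j) <= e.
  move=> e0; have [N hN] := ca _ (divr_gt0 e0 (ltr0n _ 2)).
  exists N => n Nn x i j; rewrite mxE; case: cid => l /= hl.
  rewrite [leRHS]splitr; apply: hl Nn => m k Nm Nk.
  by apply: le_trans (entry _ _ _ _ _) _; exact: hN.
have cL : continuous L.
  apply/continuous_mxP => i j; apply/continuousCP => x e e0.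
  have e3 : 0 < e / 3 by rewrite divr_gt0.
  have [N /(_ N (leqnn N)) hN] := LP _ e3.
  have /continuous_mxP/(_ i j)/continuousCP/(_ x _ e3) := @cg_cts _ _ (a N).
  apply: filterS => y hy.
  have -> : L x i j - L y i j = - ((a N x : M) i j - L x i j) +
    ((a N x : M) i j - (a N y : M) i j) + ((a N y : M) i j - L y i j) by ring.
  have -> : e = e / 3 + e / 3 + e / 3 by field.
  apply: le_lt_trans (cmodD _ _) _; apply: ltr_leD; last exact: hN.
  apply: le_lt_trans (cmodD _ _) _; apply: ler_ltD => //.
  by rewrite cmodN hN.
exists (cg_mk cL) => e e0.
pose k : R := (2 ^ s * 2 ^ s)%:R.
have k0 : 0 < k by rewrite ltr0n muln_gt0 expn_gt0.
have [N hN] := LP _ (divr_gt0 e0 k0); exists N => n Nn.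
apply: cg_norm_le => x; apply: le_trans (opnorm_le_entry_sum _) _.
apply: (@le_trans _ _ (\sum_(i < 2 ^ s) \sum_(j < 2 ^ s) e / k)).
  by apply: ler_sum => i _; apply: ler_sum => j _; rewrite cgD cgN 2!mxE hN.
rewrite !sumr_const !card_ord -mulrnA -mulr_natr.
by rewrite divfK // gt_eqF.
Qed.

HB.instance Definition _ := isCStarAlgebra.Build R CG cg_starD cg_starZ cg_starM
  cg_starK cg_normD cg_normZ cg_norm_eq0 cg_normM cg_norm_star cg_norm_complete.
End Norm.

Section OrthogonalProjection.
Variables (R : realType) (s : nat).
Implicit Types (y : Cl R s) (z : 'cV[R[i]]_(2 ^ s)).

Definition cl_complexify y : 'rV[R[i]]_(2 ^ s) :=
  map_mx (real_complex R) (y : 'rV[R]_(2 ^ s)).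

(* [proj_ortho] is the orthogonal projection for the Hermitian product [dotmx],
   for which the canonical basis (here, the e_I) is orthonormal. Its matrix acts
   on row vectors from the right; the transpose is the matrix of the same
   endomorphism acting on column vectors from the left, so that the product of
   matrices corresponds to composition. *)
Definition line_proj y : 'M[R[i]]_(2 ^ s) := (proj_ortho (cl_complexify y))^T.

Lemma line_proj_in y z : exists c, line_proj y *m z = c *: (cl_complexify y)^T.
Proof.
have /sub_rVP[c hc] := proj_ortho_sub (cl_complexify y) z^T.
by exists c; apply: trmx_inj; rewrite trmx_mul /line_proj trmxK hc linearZ /= trmxK.
Qed.

Lemma line_proj_orthogonal y z :
  dotmx (z - line_proj y *m z)^T (cl_complexify y) = 0.
Proof.
have /orthomx1P h := proj_ortho_compl_sub (cl_complexify y) z^T.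
by rewrite dotmxE linearB /= trmx_mul /line_proj trmxK h mxE.
Qed.
End OrthogonalProjection.

(* Main.v *)
(* The coordinate at e_{} = 1 is a trace tau on Cl(R^s), and the inner product
   of coordinates is <x, y> = tau(x star(y)). Hence left and right multiplication by
   a unitary are isometries, so for a unitary x each row and each column of
   (e_I x e_J) is an orthonormal basis; the projections onto the lines spanned by
   an orthonormal basis form a partition of unity. For a real unit vector y the
   matrix P_y = (y_i y_j) is polynomial in y, hence continuous, and the universal
   property of A_aut(X_n) yields pi_n. *)
Require Import Defs.
From HB Require Import structures.
From mathcomp Require Import all_boot all_order all_algebra.
From mathcomp Require Import all_classical all_reals all_analysis.
From mathcomp Require Import complex.
Set Implicit Arguments.
Unset Strict Implicit.
Unset Printing Implicit Defensive.
Import Order.TTheory GRing.Theory Num.Theory.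
Import numFieldNormedType.Exports.
Local Open Scope ring_scope.

(** * The trace at the empty set and isometries of the Clifford algebra *)

Section CliffordInnerProduct.
Variables (R : realType) (s : nat).
Implicit Types (I J : {set 'I_s}) (x y a : Cl R s).

Definition cl_dot x y : R := \sum_I cl_coord x I * cl_coord y I.

Lemma cl_dot_idx x y :
  cl_dot x y = \sum_(k < 2 ^ s)
    (x : 'rV[R]_(2 ^ s)) 0 k * (y : 'rV[R]_(2 ^ s)) 0 k.
Proof.
by rewrite [RHS](reindex (@set_idx s)) //; exists (@idx_set s) => ? _;
  rewrite ?set_idxK ?idx_setK.
Qed.

Lemma symdiff_eq0 I J : (finset.set0 == symdiff I J) = (J == I).
Proof.
apply/eqP/eqP => [E|->]; last by rewrite symdiffI.
by rewrite -[J]sym0diff -(symdiffI I) -symdiffA -E symdiff0.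
Qed.

Lemma cl_mul_coord0 x y :
  cl_coord (x * y) finset.set0 =
  \sum_I cl_coord x I * cl_coord y I * cl_sign R I I.
Proof.
rewrite cl_mul_coord; apply: eq_bigr => I _.
rewrite (bigD1 I) //= symdiff_eq0 eqxx mulr1 big1 ?addr0 // => J JI.
by rewrite symdiff_eq0 (negPf JI) mulr0.
Qed.

(** By [cl_mul_coord0] only the pairs with equal indices contribute, and the resulting sum is
    symmetric in [x] and [y]: this is the trace property. *)
Lemma cl_coord0_mulC x y :
  cl_coord (x * y) finset.set0 = cl_coord (y * x) finset.set0.
Proof.
by rewrite !cl_mul_coord0; apply: eq_bigr => I _; rewrite (mulrC (cl_coord x I)).
Qed.

(** The sign introduced by [cl_star] cancels that of the product, since signs square to one. *)
Lemma cl_dotE x y : cl_dot x y = cl_coord (x * cl_star y) finset.set0.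
Proof.
rewrite cl_mul_coord0; apply: eq_bigr => I _.
by rewrite cl_star_coord -!mulrA cl_sign_sq mulr1.
Qed.

Lemma cl_dot_mull a x y : cl_unitary R s a -> cl_dot (a * x) (a * y) = cl_dot x y.
Proof.
(* The trace property moves [a] to the right end, where it meets [cl_star a]. *)
move=> [_ aa]; rewrite !cl_dotE cl_starM -!mulrA cl_coord0_mulC -!mulrA aa.
by rewrite mulr1.
Qed.

Lemma cl_dot_mulr a x y : cl_unitary R s a -> cl_dot (x * a) (y * a) = cl_dot x y.
Proof. by move=> [aa _]; rewrite !cl_dotE cl_starM mulrA -(mulrA x) aa mulr1. Qed.

Lemma cl_basis_unitary I : cl_unitary R s (cl_basis R I).
Proof.
by split; rewrite cl_star_basis -?(scalerAl, scalerAr) cl_basis_mul symdiffI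
  scalerA cl_sign_sq scale1r.
Qed.

Lemma cl_dot_basis I J : cl_dot (cl_basis R I) (cl_basis R J) = (I == J)%:R.
Proof.
rewrite /cl_dot (bigD1 I) //= !cl_coord_basis eqxx mul1r big1 ?addr0 // => K.
by rewrite cl_coord_basis => /negPf ->; rewrite mul0r.
Qed.
End CliffordInnerProduct.

(** * Projections onto real lines as explicit matrices *)

Section LineProjections.
Variables (R : realType) (s : nat).
Implicit Types (y z : Cl R s).
Local Notation M := 'M[R[i]]_(2 ^ s).

(** This is [line_proj y] for a unit vector [y]; being quadratic in the coordinates, it makes
    continuity and products easy to handle. *)
Definition unit_proj y : M :=
  map_mx (real_complex R) ((y : 'rV[R]_(2 ^ s))^T *m (y : 'rV[R]_(2 ^ s))).

Lemma conj_real_complex (a : R) : Num.conj (real_complex R a) = real_complex R a.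
Proof. exact: conjc_real. Qed.

Lemma dot_mx11 y z : (y : 'rV[R]_(2 ^ s)) *m (z : 'rV[R]_(2 ^ s))^T = (cl_dot y z)%:M.
Proof.
apply/matrixP => i j; rewrite !ord1 !mxE eqxx mulr1n cl_dot_idx.
by apply: eq_bigr => k _; rewrite !mxE.
Qed.

Lemma unit_projM y z : cl_dot y z = 0 -> unit_proj y *m unit_proj z = 0.
Proof.
move=> yz; rewrite -map_mxM mulmxA -(mulmxA y^T) dot_mx11 mul_mx_scalar.
by rewrite yz scale0r mul0mx map_mx0.
Qed.

Lemma unit_proj_idem y : cl_dot y y = 1 -> unit_proj y *m unit_proj y = unit_proj y.
Proof.
by move=> yy; rewrite -map_mxM mulmxA -(mulmxA y^T) dot_mx11 yy mulmx1.
Qed.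

Lemma adjmx_unit_proj y : adjmx (unit_proj y) = unit_proj y.
Proof.
apply/matrixP => i j; rewrite !mxE conj_real_complex; congr (real_complex R _).
by apply: eq_bigr => k _; rewrite mulrC !mxE.
Qed.

Lemma line_proj_unit y : cl_dot y y = 1 -> line_proj y = unit_proj y.
Proof.
move=> yy; rewrite /line_proj; set v := cl_complexify y.
have vE : map_mx Num.conj v^T = v^T.
  by apply/matrixP => i j; rewrite !mxE conj_real_complex.
have vv : v *m v^T = 1%:M.
  by rewrite /v /cl_complexify map_trmx -map_mxM dot_mx11 yy map_mx1.
have -> : unit_proj y = (v^T *m v)^T.
  by rewrite trmx_mul trmxK /unit_proj map_mxM /v /cl_complexify map_trmx.
congr trmx; apply/eqP; rewrite -subr_eq0; apply/eqP.
(* The rows of this difference are orthogonal to [v], so [proj_ortho v] kills them; as it also fixes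
   [v], expanding the product identifies it with [v^T *m v]. *)
have h : (1%:M - v^T *m v) *m proj_ortho v = 0.
  apply: proj_ortho_0; apply/orthomx1P.
  by rewrite vE mulmxBl mul1mx -mulmxA vv mulmx1 subrr.
by move: h; rewrite mulmxBl mul1mx -mulmxA proj_ortho_id.
Qed.

(** The matrix [V] with rows [f i] satisfies [V *m V^T = 1]; being square, it also satisfies
    [V^T *m V = 1], whose left side is the sum of the rank-one matrices. *)
Lemma sum_unit_proj (f : 'I_(2 ^ s) -> Cl R s) :
  (forall i j, cl_dot (f i) (f j) = (i == j)%:R) ->
  \sum_i unit_proj (f i) = 1%:M.
Proof.
move=> fo; pose V : 'M[R]_(2 ^ s) := \matrix_i (f i : 'rV[R]_(2 ^ s)).
have VV : V *m V^T = 1%:M.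
  apply/matrixP => i j; rewrite !mxE -fo cl_dot_idx.
  by apply: eq_bigr => k _; rewrite !mxE.
rewrite -(map_mx1 (real_complex R)) -(mulmx1C VV) -map_mx_sum; congr map_mx.
apply/matrixP => i j; rewrite summxE mxE; apply: eq_bigr => k _.
by rewrite !mxE big_ord1 !mxE.
Qed.

Lemma continuous_unit_proj (X : topologicalType) (f : X -> Cl R s) :
  (forall I, continuous (fun x => cl_coord (f x) I : R)) ->
  continuous (fun x => unit_proj (f x)).
Proof.
move=> cf; apply/continuous_mxP => i j; apply/continuousCP => x e e0.
pose p x := cl_coord (f x) (idx_set i) * cl_coord (f x) (idx_set j).
have cp : continuous (p : X -> R) by apply: continuous_mulr.
have pE t : unit_proj (f t) i j = (p t)%:C%C.
  by rewrite !mxE big_ord1 mxE /p /cl_coord !idx_setK.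
move/cvgrPdist_lt/(_ e e0): (cp x); apply: filterS => y h.
by rewrite !pE -rmorphB cmod_real.
Qed.
End LineProjections.

(** * The magic biunitary over [CGn] and its universal property *)

Section MagicMatrix.
Variables (R : realType) (s : nat).
Implicit Types (I J : {set 'I_s}) (x : Gn R s).

Lemma cl_dot_row I J K x :
  cl_dot (cl_basis R I * val x * cl_basis R J) (cl_basis R I * val x * cl_basis R K)
  = (J == K)%:R.
Proof.
have ux : cl_unitary R s (val x) by exact: (set_mem (valP x)).
by rewrite -!mulrA !cl_dot_mull ?cl_dot_basis //; exact: cl_basis_unitary.
Qed.

Lemma cl_dot_col I J K x :
  cl_dot (cl_basis R J * val x * cl_basis R I) (cl_basis R K * val x * cl_basis R I)
  = (J == K)%:R.
Proof.
have ux : cl_unitary R s (val x) by exact: (set_mem (valP x)).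
by rewrite !cl_dot_mulr ?cl_dot_basis //; exact: cl_basis_unitary.
Qed.

Lemma continuous_magic_entry I J :
  continuous (fun x => unit_proj (cl_basis R I * val x * cl_basis R J)).
Proof.
apply: continuous_unit_proj => K x.
(* The topology of [Gn] is induced by the inclusion, so continuity is checked on the whole Clifford
   algebra. *)
apply: (@continuous_comp _ _ _ (set_val : Gn R s -> Cl R s)
  (fun z : Cl R s => cl_coord (cl_basis R I * z * cl_basis R J) K : R)).
  exact: initial_continuous.
apply: continuous_cl_coordM => L; last exact: cst_continuous.
by apply: continuous_cl_coordM => N; [exact: cst_continuous | exact: continuous_cl_coord].
Qed.

Definition magic_entry I J : CGn R s := cg_mk (@continuous_magic_entry I J).

Lemma magic_entryE I J x :
  magic_entry I J x = line_proj (cl_basis R I * val x * cl_basis R J).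
Proof. by rewrite line_proj_unit // cl_dot_row eqxx. Qed.

(** Stated for an arbitrary family [f], so that it serves both the rows and the columns. *)
Lemma orthonormal_partition (f : 'I_(2 ^ s) -> Gn R s -> Cl R s)
    (p : 'I_(2 ^ s) -> CGn R s) :
  (forall i x, p i x = unit_proj (f i x)) ->
  (forall i j x, cl_dot (f i x) (f j x) = (i == j)%:R) ->
  partition_of_unity p.
Proof.
move=> pE fo; split=> [i|i j ij|].
- split; apply: cgP => x; first by rewrite cgM pE unit_proj_idem // fo eqxx.
  by rewrite [LHS]cg_starE pE adjmx_unit_proj.
- by apply: cgP => x; rewrite cgM !pE unit_projM // fo (negPf ij).
apply: cgP => x; rewrite cg1.
(* Evaluation at [x] commutes with finite sums, addition being pointwise. *)
transitivity (\sum_i p i x); first by elim/big_rec2: _ => //= i _ y _ <-.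
by under eq_bigr do rewrite pE; apply: sum_unit_proj.
Qed.

Definition magic_matrix : 'M[CGn R s]_(2 ^ s) :=
  \matrix_(k, l) magic_entry (idx_set k) (idx_set l).

Lemma magic_matrix_biunitary : magic_biunitary magic_matrix.
Proof.
split=> i.
  apply: (@orthonormal_partition
    (fun j x => cl_basis R (idx_set i) * val x * cl_basis R (idx_set j))) => [j x|j k x].
    by rewrite mxE.
  by rewrite cl_dot_row (can_eq (@idx_setK s)).
apply: (@orthonormal_partition
  (fun j x => cl_basis R (idx_set j) * val x * cl_basis R (idx_set i))) => [j x|j k x].
  by rewrite mxE.
by rewrite cl_dot_col (can_eq (@idx_setK s)).
Qed.
End MagicMatrix.

Theorem theorem3p2 (R : realType) (s : nat) (s_ge1 : (1 <= s)%N)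
    (A : cstarAlgType R) (u : 'M[A]_(2 ^ s)) (u_univ : is_Aaut u) :
  exists pi : A -> CGn R s,
    star_morphism pi /\
    forall (I J : {set 'I_s}) (x : Gn R s),
      pi (u (set_idx I) (set_idx J)) x =
      line_proj (cl_basis R I * val x * cl_basis R J).
Proof.
have [_ /(_ _ _ (magic_matrix_biunitary R s))[pi [[pi_star pi_u] _]]] := u_univ.
exists pi; split=> // I J x.
move/matrixP/(_ (set_idx I) (set_idx J)): pi_u; rewrite !mxE !set_idxK => ->.
exact: magic_entryE.
Qed.
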